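(* Let $f=a_0+a_1z+\cdots+a_nz^n\in\mathbb{Z}[z]$ be a primitive polynomial with $a_0a_n\neq 0$. Suppose there exists a positive integer $m\geq h_f+2$ for which $f(m)=\pm p_1^{k_1}\cdots p_r^{k_r}$, where $k_1,\ldots,k_r$ are positive integers and $p_1,\ldots,p_r$ are primes which are pairwise distinct when $r\geq 2$. Suppose that for each $i=1,\ldots,r$ there is a positive integer $j_i\leq n$ such that: (i) $v_{p_i}(s_{j_i}(m))=0$ and $\gcd(k_i,j_i)=1$; (ii) if $j_i>1$, then $\frac{k_i}{j_i}<\frac{v_{p_i}(s_t(m))}{j_i-t}$ for each $t=1,\ldots,j_i-1$. Then $f$ is a product of at most $r$ irreducible polynomials in $\mathbb{Z}[z]$. In particular, if $r=1$, then $f$ is irreducible in $\mathbb{Z}[z]$.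
   Context: For $f=a_0+\cdots+a_nz^n$ with $a_n\neq0$, the height is $h_f=\max_{0\leq i\leq n-1}|a_i|/|a_n|$. For $i=0,1,\ldots,n$, $s_i(z)=f^{(i)}(z)/i!\in\mathbb{Z}[z]$, where $f^{(i)}$ is the $i$-th formal derivative (so $s_0=f$). A polynomial is primitive if the gcd of its coefficients is $1$. For a prime $p$ and nonzero integer $a$, $v_p(a)$ is the exponent of $p$ in $a$, and $v_p(0)=\infty$. *)

(* Defs.v *)
From HB Require Import structures.
From mathcomp Require Import all_boot all_order all_algebra.
From mathcomp Require Import constructive_ereal.

Set Implicit Arguments.
Unset Strict Implicit.
Unset Printing Implicit Defensive.

Import Order.TTheory GRing.Theory Num.Theory.

Local Open Scope ring_scope.

(* All ratios are nonnegative, so the default value 0 of the iterated maximum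
   matters only for n = 0. *)
Definition height (f : {poly int}) : rat :=
  \big[Num.max/0]_(i < (size f).-1) (`|f`_i|%:~R / `|lead_coef f|%:~R).

Definition primitive (f : {poly int}) : Prop :=
  \big[gcdn/0%N]_(i < size f) `|(f`_i)%R|%N = 1%N.

(* Irreducible element of an integral domain. The predicate irreducible_poly
   of polydiv ignores nonunit constant factors, hence is not the notion of
   irreducibility in Z[z]. *)
Definition irreducible_elt (R : idomainType) (x : R) : Prop :=
  [/\ x != 0, x \isn't a GRing.unit &
      forall y z : R, x = y * z -> y \is a GRing.unit \/ z \is a GRing.unit].

(* p-adic valuation (p prime), with value +oo at 0. *)
Definition vp (p : nat) (a : int) : \bar rat :=
  if a == 0 then +oo%E else ((logn p `|a|%N)%:R)%:E.

(* s_i(m) = (f^(i) / i!)(m): the library's f^`N(i) is f^(i) / i!, see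
   nderivn_def. *)
Definition sval_at (f : {poly int}) (i m : nat) : int := (f^`N(i)).[m%:Z].

(* Main.v *)
(* All roots of f have modulus less than h_f + 1 <= m - 1, so a nonconstant
   factor g of f satisfies |g(m)| > 1; a constant factor is a unit because f is
   primitive. Hence each nonunit factor has a value at m divisible by some p_i.
   The hypotheses at p_i say that the Newton polygon of f(m + z) starts with the
   segment from (0, k_i) to (j_i, 0), which has no interior lattice point and so
   cannot be split between two factors: p_i divides the value at m of at most
   one of them. Nonunit factors thus have disjoint nonempty subsets of
   {p_1, ..., p_r}. *)

Require Import Defs.
From HB Require Import structures.
From mathcomp Require Import all_boot all_order all_algebra.
From mathcomp Require Import constructive_ereal.
From mathcomp Require Import all_field zify ring.
From Stdlib Require Import Classical.

Set Implicit Arguments.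
Unset Strict Implicit.
Unset Printing Implicit Defensive.

Import Order.TTheory GRing.Theory Num.Theory.

Local Open Scope ring_scope.

(** * Weights of coefficients with respect to a line of the Newton polygon *)

(* The Newton polygon point (t, v_p(c)) lies on or above the line
   k * x + j * y = M; the case c = 0 is split off because logn p 0 = 0. *)
Definition weight_ge (p j k M : nat) (c : int) (t : nat) : bool :=
  (c == 0) || (M <= j * logn p `|c|%N + k * t)%N.

(** The valuation is ultrametric: [p ^ e], with [e] the smaller of the two valuations, divides the
    sum. *)
Lemma weight_geD p j k M c d t : prime p ->
  weight_ge p j k M c t -> weight_ge p j k M d t -> weight_ge p j k M (c + d) t.
Proof.
move=> p_pr; rewrite /weight_ge.
have [->|c0] := eqVneq c 0; first by rewrite add0r.
have [->|d0] := eqVneq d 0; first by rewrite addr0 (negbTE c0).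
have [->//|cd0] /= := eqVneq (c + d) 0.
set e := minn (logn p `|c|%N) (logn p `|d|%N) => hc hd.
have dvd_e (x : int) : x != 0 -> (e <= logn p `|x|%N)%N = ((p ^ e)%N%:Z %| x)%Z.
  by move=> x0; rewrite -pfactor_dvdn ?absz_gt0// dvdzE absz_nat.
have he : (e <= logn p `|(c + d)%R|%N)%N.
  by rewrite dvd_e // rpredD // -dvd_e // ?geq_minl ?geq_minr.
apply: leq_trans (_ : j * e + k * t <= _)%N.
  by rewrite /e /minn; case: ifP.
by rewrite leq_add2r leq_mul2l he orbT.
Qed.

Lemma weight_geN p j k M c t : weight_ge p j k M (- c) t = weight_ge p j k M c t.
Proof. by rewrite /weight_ge oppr_eq0 abszN. Qed.

Lemma weight_ge_sum p j k M t (I : Type) (r : seq I) (P : pred I) (F : I -> int) :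
  prime p -> (forall i, P i -> weight_ge p j k M (F i) t) ->
  weight_ge p j k M (\sum_(i <- r | P i) F i) t.
Proof.
move=> p_pr hF; apply: (big_ind (fun c => weight_ge p j k M c t)) => //.
by move=> c d; apply: weight_geD.
Qed.

Lemma weight_geM p j k M N c d t u :
  weight_ge p j k M c t -> weight_ge p j k N d u ->
  weight_ge p j k (M + N) (c * d) (t + u).
Proof.
rewrite /weight_ge mulf_eq0.
have [//|c0] := eqVneq c 0; have [//|d0] := eqVneq d 0; rewrite /= => hc hd.
by rewrite abszM lognM ?absz_gt0 //; lia.
Qed.

(** Negated at [M.+1], [weight_ge] says that the coefficient is nonzero of weight at most [M];
    weights of nonzero coefficients add up under products. *)
Lemma weight_ltM p j k M N c d t u :
  ~~ weight_ge p j k M.+1 c t -> ~~ weight_ge p j k N.+1 d u ->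
  ~~ weight_ge p j k (M + N).+1 (c * d) (t + u).
Proof.
rewrite /weight_ge mulf_eq0.
have [//|c0] := eqVneq c 0; have [//|d0] := eqVneq d 0; rewrite /= => hc hd.
by rewrite abszM lognM ?absz_gt0 //; lia.
Qed.

Lemma leq_weight_ge p j k M N c t :
  (M <= N)%N -> weight_ge p j k N c t -> weight_ge p j k M c t.
Proof.
by rewrite /weight_ge => le_MN /orP[->//|h]; rewrite (leq_trans le_MN h) orbT.
Qed.

(** * Initial forms and Dumas' argument *)

(* M is the minimal weight of a monomial of G, a the top degree of the initial
   form. *)
Lemma ex_min_weight p j k (G : {poly int}) : G`_0 != 0 ->
  exists M a : nat,
    [/\ forall t, weight_ge p j k M G`_t t,
        ~~ weight_ge p j k M.+1 G`_a a &
        forall t, (a < t)%N -> weight_ge p j k M.+1 G`_t t].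
Proof.
move=> G0.
pose P M := all (fun t => weight_ge p j k M G`_t t) (iota 0 (size G)).
have PE M : P M -> forall t, weight_ge p j k M G`_t t.
  move=> /allP h t; have [lt_t|le_t] := ltnP t (size G).
    by apply: h; rewrite mem_iota.
  by rewrite /weight_ge nth_default ?eqxx.
have exP : exists M, P M.
  by exists 0%N; apply/allP => t _; rewrite /weight_ge leq0n orbT.
(* The nonzero constant term bounds [M] from above, so a largest [M] exists. *)
have ubP M : P M -> (M <= j * logn p `|(G`_0)%R|%N)%N.
  by move=> /PE/(_ 0%N); rewrite /weight_ge (negbTE G0) muln0 addn0.
case: (ex_maxnP exP ubP) => M PM maxM.
pose Q t := ~~ weight_ge p j k M.+1 G`_t t.
have exQ : exists t, Q t.
  have : ~~ P M.+1 by apply/negP => /maxM; rewrite ltnn.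
  by rewrite /P -has_predC => /hasP[t _ ht]; exists t.
have ubQ t : Q t -> (t <= size G)%N.
  rewrite /Q leqNgt; apply: contra => lt_t.
  by rewrite /weight_ge nth_default ?eqxx // ltnW.
case: (ex_maxnP exQ ubQ) => a Qa maxa.
exists M, a; split; [exact: PE | exact: Qa | move=> t lt_at].
by apply/negPn/negP => /maxa; rewrite leqNgt lt_at.
Qed.

(** A squeeze: the constant terms weigh at least [M] and [N] and together [j * k], while the
    coefficient of degree [a + b] of the product weighs at least [j * k] and at most [M + N].
    Equality holds throughout. *)
Lemma dumas_arith j k M N a b gk hk ga hb f : k = (gk + hk)%N ->
  (N <= j * hb + k * b)%N -> (M <= j * ga + k * a)%N ->
  ~~ (N < j * hb + k * b)%N -> ~~ (M < j * ga + k * a)%N ->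
  ~~ (M + N < j * f + k * (a + b))%N -> (j * k <= j * f + k * (a + b))%N ->
  (N <= j * hk)%N -> (M <= j * gk)%N ->
  [/\ M + N = j * k, j * gk = j * ga + k * a & j * hk = j * hb + k * b]%N.
Proof.
move=> kE h1 h2 h3 h4 h5 h6 h7 h8.
have jkE : (j * k = j * gk + j * hk)%N by rewrite kE mulnDr.
clear kE; split; lia.
Qed.

(** Cancelling [j] gives [hk = hb + k], so one factor carries the whole valuation [k] of the
    constant term. *)
Lemma dumas_arith_full j k gk hk hb : (0 < j)%N -> k = (gk + hk)%N ->
  (j * hk = j * hb + k * j)%N -> gk = 0%N.
Proof. by move=> j0 ->; nia. Qed.

(* Dumas' argument: on the initial forms of G and H for the weight
   j * logn p c + k * t, the top degrees a and b satisfy a + b = j and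
   j | k * a, so that one of them is 0. *)
Lemma dumas_coef0 p j k (G H : {poly int}) : prime p -> coprime k j -> (0 < j)%N ->
  G`_0 * H`_0 != 0 -> (k = logn p `|((G * H)`_0)%R|)%N ->
  (forall t, weight_ge p j k (j * k) (G * H)`_t t) ->
  (forall t, t != 0%N -> t != j -> weight_ge p j k (j * k).+1 (G * H)`_t t) ->
  ~~ weight_ge p j k (j * k).+1 (G * H)`_j j ->
  ~~ ((p %| `|(G`_0)%R|)%N && (p %| `|(H`_0)%R|)%N).
Proof.
move=> p_pr cop j0; rewrite mulf_eq0 negb_or => /andP[G0 H0] kE wF wF1 wFj.
have [M [a [wG wGa wGt]]] := ex_min_weight p j k G0.
have [N [b [wH wHb wHt]]] := ex_min_weight p j k H0.
(* Of the products contributing to degree [a + b], only the one of degrees [a] and [b] has weight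
   [M + N]; all others are heavier and cannot cancel it. *)
have top : ~~ weight_ge p j k (M + N).+1 (G * H)`_(a + b) (a + b).
  have lab : (a < (a + b).+1)%N by rewrite ltnS leq_addr.
  rewrite coefM (bigD1 (Ordinal lab)) //=; set S := \sum_(i | _) _.
  have wS : weight_ge p j k (M + N).+1 S (a + b).
    apply: weight_ge_sum => // i; rewrite -val_eqE /= => ne.
    have le_i : (i <= a + b)%N by rewrite -ltnS.
    rewrite -[X in weight_ge _ _ _ _ _ X](subnKC le_i).
    have [lt_ai|le_ia] := ltnP a i.
      by rewrite -addSn; apply: weight_geM; [apply: wGt|apply: wH].
    by rewrite -addnS; apply: weight_geM; [apply: wG|apply: wHt; lia].
  apply: contra (weight_ltM wGa wHb) => wF'.
  rewrite addKn in wF'.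
  have -> : G`_a * H`_b = (G`_a * H`_b + S) + - S by rewrite addrK.
  by apply: weight_geD => //; rewrite weight_geN.
have k_eq : k = (logn p `|(G`_0)%R| + logn p `|(H`_0)%R|)%N.
  by rewrite kE coefM big_ord1 subn0 abszM lognM ?absz_gt0.
have := wG 0%N; have := wH 0%N; have := wF (a + b)%N; have := top.
have := wGa; have := wHb; have := wG a; have := wH b.
rewrite /weight_ge (negbTE G0) (negbTE H0) !muln0 !addn0 /=.
have [//|Ga0] := eqVneq G`_a 0; have [//|Hb0] := eqVneq H`_b 0.
have [//|F0 /=] := eqVneq (G * H)`_(a + b) 0.
move=> h1 h2 h3 h4 h5 h6 h7 h8.
have [MN eGa eHb] := dumas_arith k_eq h1 h2 h3 h4 h5 h6 h7 h8.
(* Away from degrees 0 and [j], every coefficient of the product weighs more than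
   [j * k = M + N]. *)
have ab : (a + b == 0)%N || (a + b == j)%N.
  apply: contraR top; rewrite negb_or => /andP[n0 nj].
  by rewrite MN wF1.
have abj : (a + b = j)%N.
  case/orP: ab => /eqP // ab0.
  (* With [a = b = 0], every contribution to degree [j > 0] would weigh more than [j * k], against
     [wFj]. *)
  have [a0 b0] : a = 0%N /\ b = 0%N by lia.
  case/negP: wFj; rewrite coefM; apply: weight_ge_sum => // i _.
  have le_i : (i <= j)%N by rewrite -ltnS.
  rewrite -[X in weight_ge _ _ _ _ _ X](subnKC le_i) -MN.
  have [lt_ai|le_ia] := ltnP a i.
    by rewrite -addSn; apply: weight_geM; [apply: wGt|apply: wH].
  by rewrite -addnS; apply: weight_geM; [apply: wG|apply: wHt; lia].
(* By [eGa], [j] divides [k * a], and coprimality removes [k]. As [a + b = j], either [a = 0] or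
   [a = j]. *)
have dvd_a : (j %| a)%N.
  rewrite -(@Gauss_dvdr j k) 1?coprime_sym //.
  by rewrite -(@dvdn_addr (j * logn p `|(G`_a)%R|)%N) ?dvdn_mulr // -eGa dvdn_mulr.
have logn0 (x : int) : x != 0 -> logn p `|x|%N = 0%N -> ~~ (p %| `|x|)%N.
  by move=> x0 lx; rewrite -[p in (p %| _)%N]expn1 pfactor_dvdn ?absz_gt0 // lx.
rewrite negb_and; case/dvdnP: dvd_a => -[|q] aE.
  apply/orP; left; apply: logn0 => //.
  have bj : b = j by lia.
  exact: dumas_arith_full j0 k_eq (etrans eHb (f_equal _ (f_equal _ bj))).
have aj : a = j by move: aE abj; clear; nia.
apply/orP; right; apply: logn0 => //.
rewrite addnC in k_eq.
exact: dumas_arith_full j0 k_eq (etrans eGa (f_equal _ (f_equal _ aj))).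
Qed.

(** * Taylor shift, root bound and values of factors *)

(** Taylor's formula at [c] with increment ['X], read over the ring of polynomials. *)
Lemma coef_comp_shift (R : comNzRingType) (f : {poly R}) (c : R) t :
  (f \Po ('X + c%:P))`_t = (f^`N(t)).[c].
Proof.
rewrite /comp_poly addrC nderiv_taylor; last exact: mulrC.
have szE : size (map_poly polyC f) = size f.
  by rewrite size_map_inj_poly //; apply: polyC_inj.
under eq_bigr => i _ do rewrite nderivn_map horner_map.
have [lt_t|le_t] := ltnP t (size f).
  rewrite coef_sum szE (bigD1 (Ordinal lt_t)) //= coefCM coefXn eqxx mulr1.
  rewrite big1 ?addr0 // => i; rewrite -val_eqE /= => ne.
  by rewrite coefCM coefXn eq_sym (negbTE ne) mulr0.
rewrite nderivn_poly0 // horner0 coef_sum big1 // => i _.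
rewrite coefCM coefXn gtn_eqF ?mulr0 //.
by apply: leq_trans le_t; rewrite -szE.
Qed.

(** Cauchy's bound: if the modulus of [x] were at least [c + 1], then, with [S] the sum of its
    powers below the [n]-th, its [n]-th power would be at least [c * S + 1], and the leading term
    would outweigh all others. *)
Lemma root_norm_lt (R : numFieldType) (f : {poly R}) (c x : R) :
  f != 0 -> 0 <= c ->
  (forall i, (i < (size f).-1)%N -> `|f`_i| <= c * `|lead_coef f|) ->
  root f x -> `|x| < c + 1.
Proof.
move=> f0 c0 hf /eqP fx0.
have rc : c + 1 \is Num.real by rewrite realE addr_ge0.
rewrite real_ltNge ?normr_real //; apply/negP => le_cx.
set n := (size f).-1 in hf.
have szf : size f = n.+1 by rewrite prednK // size_poly_gt0.
have lead0 : 0 < `|lead_coef f| by rewrite normr_gt0 lead_coef_eq0.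
set S := \sum_(i < n) `|x| ^+ i.
have S0 : 0 <= S by apply: sumr_ge0 => i _; rewrite exprn_ge0.
have le_S : `|lead_coef f| * `|x| ^+ n <= c * `|lead_coef f| * S.
  move: fx0; rewrite horner_coef szf big_ord_recr /= -[f`_n]/(lead_coef f) => /eqP.
  rewrite addrC addr_eq0 => /eqP fx.
  rewrite -normrX -normrM fx normrN mulr_sumr.
  apply: le_trans (ler_norm_sum _ _ _) _; apply: ler_sum => i _.
  by rewrite normrM normrX ler_wpM2r ?exprn_ge0 ?hf.
have : c * `|lead_coef f| * S < `|lead_coef f| * `|x| ^+ n.
  have -> : `|x| ^+ n = (`|x| - 1) * S + 1 by rewrite -subrX1 subrK.
  rewrite mulrDr mulr1 ltr_pwDr // mulrCA mulrA ler_wpM2r // ler_wpM2r ?normr_ge0 //.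
  by rewrite lerBrDr.
by move=> /(le_lt_trans le_S); rewrite ltxx.
Qed.

Lemma prod_gt1 (R : numDomainType) (s : seq R) :
  s != [::] -> (forall z, z \in s -> 1 < z) -> 1 < \prod_(z <- s) z.
Proof.
elim: s => // z s IHs _ hs; rewrite big_cons.
have z1 : 1 < z by rewrite hs ?mem_head.
have [->|s0] := eqVneq s [::]; first by rewrite big_nil mulr1.
have h : 1 < \prod_(z <- s) z by apply: IHs => // y ys; rewrite hs // in_cons ys orbT.
by rewrite mulr_egt1.
Qed.

(** Over [algC], the value of [g] at [m] is its leading coefficient times the product of the [m - z]
    over its roots [z]. Each [z] is a root of [f], so its modulus is below [m - 1]. *)
Lemma factor_horner_gt1 (f g h : {poly int}) (m : nat) :
  (1 < m)%N -> f != 0 ->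
  (forall i, (i < (size f).-1)%N -> `|f`_i| <= (m - 2)%N%:Z * `|lead_coef f|) ->
  f = g * h -> (1 < size g)%N -> (1 < `|g.[m%:Z]|)%N.
Proof.
move=> m1 f0 hf fgh szg.
pose phi (u : {poly int}) : {poly algC} := map_poly intr u.
have szphi u : size (phi u) = size u by rewrite size_map_inj_poly //; apply: intr_inj.
have g0 : g != 0 by rewrite -size_poly_gt0 (ltn_trans _ szg).
have leadphi u : lead_coef (phi u) = (lead_coef u)%:~R.
  by rewrite lead_coef_map_inj //; apply: intr_inj.
have [rs grs] := closed_field_poly_normal (phi g).
rewrite leadphi in grs.
have root_rs z : z \in rs -> 1 < `|m%:R - z|.
  move=> zrs.
  have rfz : root (phi f) z.
    have -> : phi f = phi g * phi h by rewrite fgh /phi rmorphM.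
    rewrite rootM grs rootZ ?intr_eq0 ?lead_coef_eq0 //.
    by rewrite root_prod_XsubC zrs.
  have ltz : `|z| < (m - 2)%N%:R + 1.
    apply: root_norm_lt rfz; rewrite ?ler0n //.
      by rewrite -size_poly_gt0 szphi size_poly_gt0.
    move=> i; rewrite szphi leadphi => /hf.
    by rewrite coef_map -!intr_norm -[_%:R]/(_%:Z%:~R) -intrM ler_int.
  have oneE : 1 = m%:R - ((m - 2)%N%:R + 1) :> algC.
    by rewrite -{1}(subnK m1) natrD; ring.
  have := lerB_dist (m%:R : algC) z; rewrite ger0_norm ?ler0n // => le_mz.
  by apply: lt_le_trans le_mz; rewrite [X in X < _]oneE ltrD2l ltrN2.
have : 1 < `|g.[m%:Z]|%:~R :> algC.
  rewrite intr_norm.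
  have -> : (g.[m%:Z])%:~R = (phi g).[m%:R] :> algC by rewrite -horner_map.
  rewrite grs hornerZ normrM horner_prod normr_prod.
  under eq_bigr => z _ do rewrite hornerXsubC.
  rewrite -(big_map (fun z => `|m%:R - z|) xpredT id).
  have prod1 : 1 < \prod_(y <- [seq `|m%:R - z| | z <- rs]) y.
    apply: prod_gt1 => [|y /mapP[z zrs ->]]; last exact: root_rs.
    (* A nonconstant [g] has a root; an empty product would only equal 1. *)
    apply: contraTneq szg => /(congr1 size); rewrite size_map => /size0nil rs0.
    by rewrite -szphi grs rs0 big_nil size_scale ?size_poly1 // intr_eq0 lead_coef_eq0.
  (* The leading coefficient is a nonzero integer, hence of modulus at least 1. *)
  apply: (lt_le_trans prod1); apply: ler_peMl.
    exact: ltW (lt_trans ltr01 prod1).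
  by rewrite -intr_norm -[1]/(1%:~R) ler_int -gtz0_ge1 normr_gt0 lead_coef_eq0.
by rewrite -natr_absz ltr1n.
Qed.

(** The constant divides every coefficient of [f], hence their gcd. *)
Lemma primitive_const_factor (f g h : {poly int}) :
  primitive f -> f != 0 -> f = g * h -> (size g <= 1)%N -> g \is a GRing.unit.
Proof.
move=> prim_f f0 fgh /size1_polyC gE; set c := g`_0 in gE.
have : (`|c| %| 1)%N.
  rewrite -prim_f; apply/dvdn_biggcdP => i _.
  have -> : f`_i = c * h`_i by move: (val i) => t; rewrite fgh gE coefCM.
  by rewrite abszM dvdn_mulr.
rewrite dvdn1 => /eqP c1.
have cU : c \is a GRing.unit.
  have cE : c = 1 \/ c = -1 by lia.
  by case: cE => ->; rewrite ?unitrN1 ?unitr1.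
by rewrite gE rmorph_unit.
Qed.

(** * Counting irreducible factors *)

(** Induction on the cardinality of [S g], later the set of primes [p i] dividing the value of [g]
    at [m]: nonunits [a] and [b] with [g = a * b] have disjoint nonempty sets inside [S g], hence
    smaller ones. The cofactor [h] is carried along because nonemptiness and disjointness are
    assumed only for divisors of [f]. *)
Lemma irreducible_factorization_card (R : idomainType) (I : finType)
    (S : R -> {set I}) (f : R) :
  f != 0 ->
  (forall g h, f = g * h -> g \isn't a GRing.unit -> S g != set0) ->
  (forall g h, S g \subset S (g * h)) ->
  (forall g h, f = g * h -> [disjoint S g & S h]) ->
  forall g h, f = g * h -> g \isn't a GRing.unit ->
  exists s : seq R, [/\ (size s <= #|S g|)%N,
    forall q, q \in s -> irreducible_elt q & g = \prod_(q <- s) q].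
Proof.
move=> f0 Sn0 Smul Sdisj g.
have [n le_n] := ubnP #|S g|; elim: n => // n IHn in g le_n *.
move=> h fgh gU.
have Sg := Sn0 _ _ fgh gU.
have g0 : g != 0 by apply: contraNneq f0 => g0; rewrite fgh g0 mul0r.
have [g_irr|g_red] := classic (irreducible_elt g).
  exists [:: g]; split; first by rewrite card_gt0.
    by move=> q; rewrite inE => /eqP->.
  by rewrite big_seq1.
have [a [b [gab aU bU]]] : exists a b,
    [/\ g = a * b, a \isn't a GRing.unit & b \isn't a GRing.unit].
  apply: NNPP => no_ab; apply: g_red; split=> // a b gab.
  have [aU|aU] := boolP (a \is a GRing.unit); first by left.
  right; apply/negPn/negP => bU; apply: no_ab; exists a, b; by split.
have fa : f = a * (b * h) by rewrite mulrA -gab.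
have fb : f = b * (a * h) by rewrite mulrCA mulrA -gab.
have dab : [disjoint S a & S b].
  by apply: disjointWr (Sdisj _ _ fa); apply: Smul.
have Sa : (0 < #|S a|)%N by rewrite card_gt0 (Sn0 _ _ fa).
have Sb : (0 < #|S b|)%N by rewrite card_gt0 (Sn0 _ _ fb).
have le_ab : (#|S a| + #|S b| <= #|S g|)%N.
  rewrite -cardsUI disjoint_setI0 // cards0 addn0 subset_leq_card // subUset gab.
  by rewrite Smul mulrC Smul.
have [s [les irrs aE]] := IHn a ltac:(lia) _ fa aU.
have [t [le_t irrt bE]] := IHn b ltac:(lia) _ fb bU.
exists (s ++ t); split.
- by rewrite size_cat (leq_trans (leq_add les le_t)).
- by move=> q; rewrite mem_cat => /orP[/irrs|/irrt].
- by rewrite big_cat /= -aE -bE.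
Qed.

(** * Application at the point [m] *)

(** Dumas' argument applies after the shift by [m], which turns the values at [m] into constant
    terms and the [sval_at f t m] into the coefficients of the shifted [f]. *)
Lemma dumas_horner (f g h : {poly int}) (m p k j : nat) :
  prime p -> (0 < k)%N -> (0 < j)%N -> coprime k j ->
  f.[m%:Z] != 0 -> logn p `|f.[m%:Z]|%N = k ->
  vp p (sval_at f j m) = 0%E ->
  (forall t, (0 < t < j)%N ->
     ((k%:R / j%:R : rat)%:E < vp p (sval_at f t m) / ((j - t)%N%:R)%:E)%E) ->
  f = g * h -> ~~ ((p %| `|g.[m%:Z]|)%N && (p %| `|h.[m%:Z]|)%N).
Proof.
move=> p_pr k0 j0 cop fm0 fmk vj vt fgh.
pose sh (u : {poly int}) := u \Po ('X + (m%:Z)%:P).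
have shE u t : (sh u)`_t = sval_at u t m by rewrite coef_comp_shift.
have sh0 u : (sh u)`_0 = u.[m%:Z] by rewrite shE /sval_at nderivn0.
have shM : sh g * sh h = sh f by rewrite fgh /sh comp_polyM.
have vjE : sval_at f j m != 0 /\ logn p `|sval_at f j m|%N = 0%N.
  move: vj; rewrite /vp; case: eqP => // /eqP h0 [/eqP].
  by rewrite pnatr_eq0 => /eqP.
have wj : weight_ge p j k (j * k) (sval_at f j m) j.
  by rewrite /weight_ge vjE.2 mulnC leq_addl orbT.
have w0 : weight_ge p j k (j * k) f.[m%:Z] 0.
  by rewrite /weight_ge fmk leq_addr orbT.
(* For [t > j] the term [k * t] alone exceeds [j * k]. For [t < j], clearing denominators in the
   slope condition gives [k * (j - t) < j * v], with [v] the valuation of [sval_at f t m] when this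
   is nonzero. *)
have w_lt t : t != 0%N -> t != j -> weight_ge p j k (j * k).+1 (sval_at f t m) t.
  move=> t0 tj; have [lt_jt|le_tj] := ltnP j t.
    by rewrite /weight_ge; apply/orP; right; nia.
  have tj' : (0 < t < j)%N by lia.
  move: (vt t tj'); rewrite /vp /weight_ge; have [//|s0] := eqVneq (sval_at f t m) 0.
  have jt0 : (0 < j - t)%N by lia.
  rewrite inver pnatr_eq0 gtn_eqF // -EFinM lte_fin.
  rewrite ltr_pdivrMr ?ltr0n // mulrAC ltr_pdivlMr ?ltr0n //.
  rewrite -!natrM ltr_nat /= => lt_k.
  have : (j * k = k * (j - t) + k * t)%N by rewrite -mulnDr subnK // mulnC.
  lia.
rewrite -!sh0; apply: (dumas_coef0 p_pr cop j0); rewrite ?shM ?sh0 //.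
- by rewrite -hornerM -fgh.
- move=> t; rewrite shE; have [->|t0] := eqVneq t 0%N.
    by rewrite /sval_at nderivn0.
  have [->//|tj] := eqVneq t j.
  exact: leq_weight_ge (w_lt _ t0 tj).
- by move=> t t0 tj; rewrite shE; apply: w_lt.
- by rewrite shE /weight_ge (negbTE vjE.1) vjE.2 muln0 add0n mulnC ltnn.
Qed.

Lemma logn_prod_primes r (p k : 'I_r -> nat) (i : 'I_r) :
  (forall l, prime (p l)) -> injective p ->
  logn (p i) (\prod_(l < r) p l ^ k l) = k i.
Proof.
move=> p_pr p_inj; rewrite (bigD1 i) //= mulnC logn_Gauss.
  by rewrite pfactorK.
apply: (big_ind (coprime (p i))) => [|x y cx cy|l ne_li]; first exact: coprimen1.
  by rewrite coprimeMr cx.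
apply: coprimeXr; rewrite prime_coprime // dvdn_prime2 //.
by apply: contra ne_li => /eqP/p_inj ->.
Qed.

Theorem theorem1 (f : {poly int}) (n : nat) (hn : size f = n.+1)
    (hprim : primitive f) (h0n : f`_0 * f`_n != 0)
    (m : nat) (hm0 : (0 < m)%N) (hm : height f + 2 <= m%:R)
    (r : nat) (hr : (0 < r)%N) (p k : 'I_r -> nat)
    (hp : forall i, prime (p i)) (hpinj : injective p)
    (hk : forall i, (0 < k i)%N)
    (hfm : f.[m%:Z] = (\prod_(i < r) p i ^ k i)%N%:Z \/
           f.[m%:Z] = - (\prod_(i < r) p i ^ k i)%N%:Z)
    (hj : forall i : 'I_r, exists j : nat,
        [/\ (0 < j <= n)%N,
            vp (p i) (sval_at f j m) = 0%E,
            coprime (k i) j &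
            (1 < j)%N -> forall t : nat, (1 <= t <= j.-1)%N ->
              (((k i)%:R / j%:R : rat)%:E
                 < vp (p i) (sval_at f t m) / ((j - t)%N%:R)%:E)%E]) :
  (exists s : seq {poly int},
     [/\ (size s <= r)%N,
         forall g, g \in s -> irreducible_elt g &
         f = \prod_(g <- s) g])
  /\ (r = 1%N -> irreducible_elt f).
Proof.
have f0 : f != 0 by rewrite -size_poly_gt0 hn.
have fmE : `|f.[m%:Z]|%N = (\prod_(i < r) p i ^ k i)%N.
  by case: hfm => ->; rewrite ?abszN absz_nat.
have fm0 : f.[m%:Z] != 0.
  rewrite -absz_gt0 fmE prodn_gt0 // => i.
  by rewrite expn_gt0 prime_gt0.
have n0 : (0 < n)%N.
  by have [j [/andP[j0 jn] _ _ _]] := hj (Ordinal hr); apply: leq_trans jn.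
have height0 : 0 <= height f.
  exact: bigmax_ge_id.
(* This makes the truncated difference [m - 2] a genuine one. *)
have m1 : (1 < m)%N.
  by rewrite -(ler_nat rat); apply: le_trans hm; rewrite lerDr.
have coef_le i : (i < (size f).-1)%N -> `|f`_i| <= (m - 2)%N%:Z * `|lead_coef f|.
  move=> lt_i.
  have l0 : 0 < `|lead_coef f|%:~R :> rat.
    by rewrite ltr0z normr_gt0 lead_coef_eq0.
  have : `|f`_i|%:~R / `|lead_coef f|%:~R <= (m - 2)%N%:R :> rat.
    rewrite natrB // lerBrDr; apply: le_trans hm; rewrite lerD2r.
    exact: (le_bigmax (0 : rat) (fun i : 'I_(size f).-1 =>
              `|f`_i|%:~R / `|lead_coef f|%:~R) (Ordinal lt_i)).
  by rewrite ler_pdivrMr // -[_%:R]/(_%:Z%:~R) -intrM ler_int.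
pose S (g : {poly int}) := [set i : 'I_r | (p i %| `|g.[m%:Z]|)%N].
have S_n0 g h : f = g * h -> g \isn't a GRing.unit -> S g != set0.
  move=> fgh gU.
  have szg : (1 < size g)%N.
    by rewrite ltnNge; apply: contra gU; apply: primitive_const_factor fgh.
  have g1 := factor_horner_gt1 m1 f0 coef_le fgh szg.
  (* Any prime divisor of the value of [g] divides that of [f], so it is one of the [p i]. *)
  have : (pdiv `|g.[m%:Z]| %| \prod_(i < r) p i ^ k i)%N.
    by rewrite -fmE fgh hornerM abszM dvdn_mulr // pdiv_dvd.
  rewrite Euclid_dvd_prod ?pdiv_prime // big_has => /hasP[i _ dvd_i].
  have /eqP pE : pdiv `|g.[m%:Z]| == p i.
    move: dvd_i; rewrite Euclid_dvdX ?pdiv_prime // => /andP[dvd_i _].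
    by rewrite -dvdn_prime2 ?pdiv_prime.
  by apply/set0Pn; exists i; rewrite inE -pE pdiv_dvd.
have S_mul g h : S g \subset S (g * h).
  by apply/subsetP => i; rewrite !inE hornerM abszM; apply: dvdn_mulr.
have S_disj g h : f = g * h -> [disjoint S g & S h].
  move=> fgh; rewrite -setI_eq0; apply/eqP/setP => i; rewrite !inE.
  have [j [/andP[j0 jn] vj cop vt]] := hj i.
  apply/negbTE; apply: (dumas_horner (hp i) (hk i) j0 cop fm0 _ vj _ fgh).
    by rewrite fmE logn_prod_primes.
  by move=> t ht; apply: vt; lia.
have f_fac := irreducible_factorization_card f0 S_n0 S_mul S_disj.
(* The factor is [f] itself with cofactor 1; it is not a unit because its degree [n] is positive. *)
have [|s [les irrs fE]] := f_fac _ _ (esym (mulr1 f)).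
  by rewrite poly_unitE hn; case: n n0 {hn h0n hj}.
have le_sr : (size s <= r)%N by rewrite -[r]card_ord (leq_trans les) // max_card.
split; first by exists s.
(* An empty factorization would give [f = 1], against [n > 0], so exactly one factor remains. *)
move=> r1; case: s fE irrs le_sr {les} => [|q [|q' s]] fE irrs; rewrite r1 // => _.
  by move: hn; rewrite fE big_nil size_poly1; lia.
by rewrite fE big_seq1; apply: irrs; rewrite mem_head.
Qed.
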